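(* Let $p\in[1,+\infty]$, let $\Lambda\subset\mathbb{Z}^d$ be finite and nonempty, and let $\mu,\nu\in\mathcal{M}^1(\Omega_\Lambda)$. Then $$Q_{p,\Lambda}(\mu,\nu)=D_{p,\Lambda}(\mu,\nu).$$
   Context: $S$ is a finite set, $d\ge 1$; for a finite nonempty set $\Lambda\subset\mathbb{Z}^d$, $\Omega_\Lambda=S^\Lambda$ and $\mathcal{M}^1(\Omega_\Lambda)$ is the set of probability measures on $\Omega_\Lambda$. For $f:\Omega_\Lambda\to\mathbb{R}$ and $i\in\Lambda$, the oscillation of $f$ at $i$ is $\delta_i f=\sup\{f(\sigma)-f(\tilde\sigma):\sigma_j=\tilde\sigma_j\ \forall j\neq i\}$, and $\|\delta f\|_q=(\sum_{i\in\Lambda}(\delta_i f)^q)^{1/q}$ for $1\le q<\infty$, $\|\delta f\|_\infty=\sup_{i\in\Lambda}\delta_i f$. Integral probability metric: with $q\in[1,+\infty]$ the conjugate exponent of $p$ ($1/p+1/q=1$), $$D_{p,\Lambda}(\nu,\mu)=\sup_{f:\Omega_\Lambda\to\mathbb{R}\text{ non-constant}}\frac{\int f\,d\nu-\int f\,d\mu}{\|\delta f\|_q}=\sup_{f:\ \|\delta f\|_q\le 1}\Big(\int f\,d\nu-\int f\,d\mu\Big).$$ Coupling functional: let $\mathcal{C}_\Lambda(\mu,\nu)$ be the set of couplings of $\mu$ and $\nu$, i.e. probability measures $\Pi$ on $\Omega_\Lambda\times\Omega_\Lambda$ with first marginal $\mu$ and second marginal $\nu$; a generic point of $\Omega_\Lambda\times\Omega_\Lambda$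 is written $(\sigma^{(1)},\sigma^{(2)})$. For $1\le p<\infty$, $$Q_{p,\Lambda}(\mu,\nu)=\Big(\inf_{\Pi\in\mathcal{C}_\Lambda(\mu,\nu)}\sum_{i\in\Lambda}\big(\Pi\{\sigma^{(1)}_i\ne\sigma^{(2)}_i\}\big)^p\Big)^{1/p},$$ and $Q_{\infty,\Lambda}(\mu,\nu)=\inf_{\Pi\in\mathcal{C}_\Lambda(\mu,\nu)}\sup_{i\in\Lambda}\Pi\{\sigma^{(1)}_i\ne\sigma^{(2)}_i\}$. *)

(* Defs.v *)
From HB Require Import structures.
From mathcomp Require Import all_boot all_order all_algebra finmap.
From mathcomp Require Import all_classical all_reals all_analysis.
Set Implicit Arguments.
Unset Strict Implicit.
Unset Printing Implicit Defensive.
Import Order.TTheory GRing.Theory Num.Theory.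
Import numFieldNormedType.Exports.

Local Open Scope classical_set_scope.
Local Open Scope ring_scope.

(* Nonempty finite types: [measurableType] requires a point, and there is no
   probability measure on S^Lambda when S is empty and Lambda is not. *)
#[short(type="pointedFinType")]
HB.structure Definition PointedFinite := {T of Finite T & isPointed T}.

Section config.
Context (S : pointedFinType) (I : finType).

(* The finite set S^I, with the discrete sigma-algebra. *)
Definition config := {ffun I -> S}.

HB.instance Definition _ := Finite.on config.
HB.instance Definition _ := isPointed.Build config [ffun=> point].
HB.instance Definition _ := @isMeasurable.Build default_measure_display
  config discrete_measurable discrete_measurable0
  discrete_measurableC discrete_measurableU.

End config.

Section metrics.
Context {R : realType} {S : pointedFinType} {I : finType}.
Local Notation Omega := (config S I).

Definition osc (f : Omega -> R) (i : I) : R :=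
  sup [set x | exists s t : Omega,
                 (forall j, j != i -> s j = t j) /\ x = f s - f t].

(* l^q norm on nonnegative families; the value at q = -oo is irrelevant. *)
Definition lqnorm (q : \bar R) (x : I -> R) : R :=
  match q with
  | r%:E => (\sum_i x i `^ r) `^ r^-1
  | +oo%E => sup (range x)
  | -oo%E => 0
  end.

(* The extended-real supremum is over a set containing 0 (f constant). *)
Definition ipm (p : \bar R) (nu mu : probability Omega R) : \bar R :=
  ereal_sup [set (\int[nu]_x f x - \int[mu]_x f x)%:E | f in
    [set f : Omega -> R | lqnorm (hoelder_conjugate p) (osc f) <= 1]].

Definition coupling (mu nu : probability Omega R) :
    set (probability (Omega * Omega)%type R) :=
  [set Pi | (forall A : set Omega, measurable A -> Pi (fst @^-1` A) = mu A) /\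
            (forall A : set Omega, measurable A -> Pi (snd @^-1` A) = nu A)].

Definition disagree (i : I) := [set s : Omega * Omega | s.1 i != s.2 i].

(* Computed in [0, +oo], where the infima need no side condition; the value at
   p = -oo is irrelevant. *)
Definition coupling_dist (p : \bar R) (mu nu : probability Omega R) : \bar R :=
  match p with
  | r%:E => (ereal_inf [set \sum_i (Pi (disagree i)) `^ r |
                          Pi in coupling mu nu] `^ r^-1)%E
  | +oo%E => ereal_inf [set ereal_sup (range (fun i => Pi (disagree i))) |
                          Pi in coupling mu nu]
  | -oo%E => 0%E
  end.

Lemma fun_bounded (f : Omega -> R) : exists2 M, 0 <= M & forall s, `|f s| <= M.
Proof.
exists (\sum_s `|f s|); first by apply: sumr_ge0.
by move=> s; rewrite (bigD1 s)//= lerDl sumr_ge0.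
Qed.

Lemma osc_ub (f : Omega -> R) i (s t : Omega) :
  (forall j, j != i -> s j = t j) -> f s - f t <= osc f i.
Proof.
move=> st; apply: ub_le_sup; last by exists s, t.
have [M M0 fM] := fun_bounded f; exists (M + M) => _ [u [v [_ ->]]].
by rewrite (le_trans (ler_norm _))// (le_trans (ler_normB _ _))// lerD.
Qed.

Lemma osc_le (f : Omega -> R) i (M : R) :
  (forall s t : Omega, (forall j, j != i -> s j = t j) -> f s - f t <= M) ->
  osc f i <= M.
Proof.
move=> h; apply: ge_sup; last by move=> _ [s [t [st ->]]]; exact: h.
by exists (f point - f point), point, point.
Qed.

Lemma osc_ge0 (f : Omega -> R) i : 0 <= osc f i.
Proof. by rewrite -(subrr (f point)) osc_ub. Qed.

Lemma oscZ (c : R) (f : Omega -> R) i : 0 < c ->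
  osc (fun s => c * f s) i = c * osc f i.
Proof.
move=> c0; apply/eqP; rewrite eq_le; apply/andP; split.
  by apply: osc_le => s t st; rewrite -mulrBr ler_pM2l// osc_ub.
rewrite -ler_pdivlMl//; apply: osc_le => s t st.
by rewrite ler_pdivlMl// mulrBr; exact: (@osc_ub (fun s => c * f s)).
Qed.

Lemma osc_eq0 (f : Omega -> R) : (forall i, osc f i = 0) ->
  forall s t, f s = f t.
Proof.
move=> f0 s t; have [n] := ubnP #|[pred j | s j != t j]|.
elim: n s => // n IH s; rewrite ltnS => sn.
have [st|/forallPn[i sti]] := boolP [forall i, s i == t i].
  by congr f; apply/ffunP => i; apply/eqP/(forallP st).
pose s' : Omega := [ffun j => if j == i then t i else s j].
have ss' j : j != i -> s j = s' j by move=> ji; rewrite ffunE (negbTE ji).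
have -> : f s = f s'.
  apply/eqP; rewrite eq_le -subr_le0 -[X in _ && X]subr_le0 -(f0 i).
  by rewrite !osc_ub// => j /ss'.
apply: IH; apply: leq_trans sn; apply: proper_card; apply/properP; split.
  by apply/fintype.subsetP => j; rewrite !inE ffunE; case: (eqVneq j i) => [->|//]; rewrite eqxx.
by exists i; rewrite !inE ?ffunE ?eqxx.
Qed.

Lemma sup_family_ub (x : I -> R) i : x i <= sup (range x).
Proof.
apply: ub_le_sup; last by exists i.
exists (\sum_j `|x j|) => _ [j _ <-]; rewrite (le_trans (ler_norm _))//.
by rewrite (bigD1 j)//= lerDl sumr_ge0.
Qed.

Lemma lqnormZ q (c : R) (x : I -> R) : (0 < #|I|)%N -> (1 <= q)%E -> 0 < c ->
  (forall i, 0 <= x i) -> lqnorm q (fun i => c * x i) = c * lqnorm q x.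
Proof.
move=> /card_gt0P[i0 _]; case: q => [r|_|//] /=; last first.
  move=> c0 x0; apply/eqP; rewrite eq_le; apply/andP; split.
    apply: ge_sup; first by exists (c * x i0), i0.
    by move=> _ [i _ <-]; rewrite ler_pM2l// sup_family_ub.
  rewrite -ler_pdivlMl//; apply: ge_sup; first by exists (x i0), i0.
  move=> _ [i _ <-]; rewrite ler_pdivlMl//.
  exact: (sup_family_ub (fun i => c * x i)).
rewrite lee_fin => r1 c0 x0; have r0 : r != 0 by rewrite gt_eqF// (lt_le_trans _ r1).
under eq_bigr do rewrite powRM ?(ltW c0)//.
rewrite -mulr_sumr powRM ?powR_ge0//; last first.
  by apply: sumr_ge0 => i _; rewrite powR_ge0.
by rewrite -powRrM divff// powRr1// ltW.
Qed.

Lemma lqnorm_gt0 q (x : I -> R) : (1 <= q)%E ->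
  (forall i, 0 <= x i) -> (exists i, x i != 0) -> 0 < lqnorm q x.
Proof.
move=> + x0 [i xi0]; have xi : 0 < x i by rewrite lt_neqAle eq_sym xi0 x0.
case: q => [r|_|//] /=; last exact: lt_le_trans (sup_family_ub x i).
move=> _; apply: powR_gt0; apply: lt_le_trans (powR_gt0 r xi) _.
by rewrite (bigD1 i)//= lerDl sumr_ge0// => j _; rewrite powR_ge0.
Qed.

Lemma config_integrable (mu : probability Omega R) (f : Omega -> R) :
  mu.-integrable setT (EFin \o f).
Proof.
apply: measurable_bounded_integrable => //.
  by have := probability_setT mu; rewrite /= => ->; rewrite ltry.
have [M _ fM] := fun_bounded f; exists M; split; first exact: num_real.
by move=> N MN s _; exact: le_trans (fM s) (ltW MN).
Qed.

(* The two usual expressions for the metric agree, except that there is no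
   non-constant function when S^I is a singleton. *)
Lemma ipm_ratio (p : \bar R) (nu mu : probability Omega R) : (1 <= p)%E ->
  (exists f : Omega -> R, exists s t, f s != f t) ->
  ipm p nu mu =
  ereal_sup [set ((\int[nu]_x f x - \int[mu]_x f x) /
                  lqnorm (hoelder_conjugate p) (osc f))%:E | f in
    [set f : Omega -> R | exists s t, f s != f t]].
Proof.
move=> /hoelder_conj_ge1; rewrite /ipm; move: (hoelder_conjugate p) => q q1.
move=> [f0 [s0 [t0 st0]]].
have oscN0 (f : Omega -> R) : (exists s t, f s != f t) -> exists i, osc f i != 0.
  move=> [s [t fst]]; apply: contrapT => /forallNP h; case/eqP: fst.
  by apply: osc_eq0 => i; apply/eqP/negPn/negP; exact: h.
have I0 : (0 < #|I|)%N.
  by have [|i _] := oscN0 f0; [exists s0, t0|apply/card_gt0P; exists i].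
have norm_gt0 (f : Omega -> R) :
    (exists s t, f s != f t) -> 0 < lqnorm q (osc f).
  by move=> /oscN0; apply: lqnorm_gt0 => // i; exact: osc_ge0.
have scale (c : R) (f : Omega -> R) : 0 < c ->
    (lqnorm q (osc (fun s => c * f s)) = c * lqnorm q (osc f)) *
    (\int[nu]_x (c * f x) - \int[mu]_x (c * f x) =
      c * (\int[nu]_x f x - \int[mu]_x f x)).
  move=> c0; split; last by rewrite !RintegralZl ?mulrBr//; exact: config_integrable.
  rewrite -lqnormZ//; last exact: osc_ge0.
  by congr lqnorm; apply/funext => i; rewrite oscZ.
have upper (f : Omega -> R) : (exists s t, f s != f t) ->
    (((\int[nu]_x f x - \int[mu]_x f x) / lqnorm q (osc f))%:E <=
     ereal_sup [set ((\int[nu]_x f x - \int[mu]_x f x) / lqnorm q (osc f))%:E |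
       f in [set f : Omega -> R | exists s t, f s != f t]])%E.
  by move=> fst; apply: ereal_sup_ubound; exists f.
have ratio_ge0 : (0 <= ereal_sup
    [set ((\int[nu]_x f x - \int[mu]_x f x) / lqnorm q (osc f))%:E |
       f in [set f : Omega -> R | exists s t, f s != f t]])%E.
  have [h|h] := leP 0 (\int[nu]_x f0 x - \int[mu]_x f0 x).
    apply: le_trans (upper f0 _); last by exists s0, t0.
    by rewrite lee_fin divr_ge0// ltW// norm_gt0//; exists s0, t0.
  have ncN : exists s t, - f0 s != - f0 t by exists s0, t0; rewrite eqr_opp.
  apply: le_trans (upper (fun s => - f0 s) ncN); rewrite lee_fin.
  apply: divr_ge0; last by rewrite ltW// norm_gt0.
  have intN (P : probability Omega R) : \int[P]_x (- f0 x) = - \int[P]_x f0 x.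
    under eq_Rintegral do rewrite -mulN1r.
    by rewrite RintegralZl ?mulN1r//; exact: config_integrable.
  by rewrite !intN -opprD oppr_ge0 ltW.
apply/eqP; rewrite eq_le; apply/andP; split; apply: ge_ereal_sup => _ [f /= fP <-].
  have [fst|] := pselect (exists s t, f s != f t).
    have [h|h] := leP 0 (\int[nu]_x f x - \int[mu]_x f x).
      apply: le_trans (upper _ fst); rewrite lee_fin ler_pdivlMr ?norm_gt0//.
      by rewrite ler_piMr.
    by apply: le_trans ratio_ge0; rewrite lee_fin ltW.
  move=> fcst; have fE : f = cst (f point).
    apply/funext => s; apply/eqP/negPn/negP => fs; apply: fcst.
    by exists s, point.
  rewrite fE !Rintegral_cst//.
  rewrite (_ : _ - _ = 0)//.
  have -> : fine (nu setT) = fine (mu setT) by rewrite !probability_setT.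
  by rewrite subrr.
apply: ereal_sup_ubound; pose c := (lqnorm q (osc f))^-1.
have c0 : 0 < c by rewrite invr_gt0 norm_gt0.
exists (fun s => c * f s); rewrite /= !scale//.
  by rewrite mulVf// gt_eqF// norm_gt0.
by rewrite mulrC.
Qed.

End metrics.

(* Main.v *)
Require Import Defs.
From mathcomp Require Import all_boot all_order all_algebra finmap.
From mathcomp Require Import all_classical all_reals all_analysis.
From mathcomp Require Import ring lra.

(* If [ipm p mu nu = c], let [P g] be the least value of
   [mu phi + nu psi + c * ||l||_q] over potentials and weights [l >= 0] with
   [g (s, t) <= phi s + psi t + sum_(i | s i != t i) l i].  The bound by [c]
   makes [P 0 = 0], so [P] is sublinear, and a linear functional below [P]
   (Hahn-Banach) is integration against a coupling whose disagreement
   probabilities [a] satisfy [<l, a> <= c * ||l||_q], i.e. [||a||_p <= c].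
   This coupling attains the infimum; the converse inequality is Hoelder's. *)

Set Implicit Arguments.
Unset Strict Implicit.
Unset Printing Implicit Defensive.
Import Order.TTheory GRing.Theory Num.Theory.
Import numFieldNormedType.Exports.
Local Open Scope classical_set_scope.
Local Open Scope ring_scope.

(** * Sublinear functionals and a Hahn-Banach theorem for finite families of vectors *)

Section hahn_banach.
Context {R : realType} {V : lmodType R}.
Implicit Types (P : V -> R) (x y e : V).

(** The inequality for positive scalars amounts to equality, by applying it again to [a^-1]. *)
Definition sublinear P :=
  (forall x y, P (x + y) <= P x + P y) /\
  (forall (a : R) x, 0 < a -> P (a *: x) <= a * P x).

Lemma sublinear0 P : sublinear P -> P 0 = 0.
Proof.
move=> [_ PZ]; have := PZ 2 0 (ltr0n _ 2); have := PZ 2^-1 0.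
by rewrite !scaler0 invr_gt0 ltr0n => /(_ isT); lra.
Qed.

Lemma sublinearN P x : sublinear P -> 0 <= P x + P (- x).
Proof. by move=> Ps; rewrite -(sublinear0 Ps) -(subrr x); case: Ps. Qed.

(** Read [A x] as the set of costs at which [x] can be achieved. Any [b] in [A (- x)] bounds [A x]
    below by [- b], since [a + b] lies in [A 0] for every [a] in [A x]; hence each infimum is
    finite. *)
Lemma sublinear_inf (A : V -> set R) :
  (forall x, A x !=set0) -> (forall a, A 0 a -> 0 <= a) ->
  (forall x y a b, A x a -> A y b -> A (x + y) (a + b)) ->
  (forall x (r a : R), 0 < r -> A x a -> A (r *: x) (r * a)) ->
  sublinear (fun x => inf (A x)) /\ (forall x a, A x a -> inf (A x) <= a).
Proof.
move=> A_neq0 A0 AD AZ.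
have infA x a : A x a -> inf (A x) <= a.
  move=> Axa; apply: ge_inf => //; have [b Ab] := A_neq0 (- x).
  exists (- b) => c Ac; rewrite -subr_ge0 opprK; apply: A0.
  by rewrite -(subrr x); exact: AD.
split=> //; split=> [x y|r x r0] /=.
- rewrite -lerBlDr; apply: lb_le_inf => // a Aa.
  rewrite lerBlDr [a + _]addrC -lerBlDr; apply: lb_le_inf => // b Ab.
  by rewrite lerBlDr [b + _]addrC; apply: infA; exact: AD.
- rewrite -ler_pdivrMl//; apply: lb_le_inf => // a Aa.
  by rewrite ler_pdivrMl//; apply: infA; exact: AZ.
Qed.

(** One Hahn-Banach step: [P' x] is the infimum of [P (x + t *: e) - t * P e] over [t >= 0]. Taking
    [t = 0] gives [P' <= P], and [t = 1] at [x = - e] gives [P' (- e) <= - P e], so [P'] is linear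
    along [e]. *)
Lemma sublinear_straighten P e : sublinear P ->
  exists P', [/\ sublinear P', forall x, P' x <= P x & P' e + P' (- e) <= 0].
Proof.
move=> Ps; have [PD PZ] := Ps.
pose A x := [set r | exists2 t, 0 <= t & P (x + t *: e) - t * P e <= r].
have [] := @sublinear_inf A.
- by move=> x; exists (P (x + 0 *: e) - 0 * P e), 0.
- move=> a [t]; rewrite add0r le_eqVlt => /predU1P[<-|t0].
    by rewrite scale0r (sublinear0 Ps) mul0r subr0.
  apply: le_trans; rewrite subr_ge0 -ler_pdivlMl//.
  by apply: le_trans (PZ _ _ _); rewrite ?invr_gt0// scalerK// gt_eqF.
- move=> x y a b [t t0 xa] [u u0 yb]; exists (t + u); first exact: addr_ge0.
  rewrite scalerDl addrACA mulrDl; have := PD (x + t *: e) (y + u *: e).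
  by move: xa yb; lra.
- move=> x r a r0 [t t0 xa]; exists (r * t); first by rewrite mulr_ge0// ltW.
  rewrite -scalerA -scalerDr -mulrA.
  apply: (@le_trans _ _ (r * (P (x + t *: e) - t * P e))).
    by rewrite mulrBr lerD2r PZ.
  by rewrite ler_pM2l.
move=> P's P'le; exists (fun x => inf (A x)).
have P'P x : inf (A x) <= P x.
  by apply: P'le; exists 0; rewrite // scale0r addr0 mul0r subr0.
split=> //; rewrite -[leRHS](subrr (P e)); apply: lerD => //; apply: P'le.
by exists 1 => //; rewrite scale1r addNr (sublinear0 Ps) mul1r add0r.
Qed.

(** Later steps only lower the functional, so they keep the inequalities gained earlier. *)
Lemma sublinear_straighten_seq P (s : seq V) : sublinear P ->
  exists P', [/\ sublinear P', forall x, P' x <= P x &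
    forall e, e \in s -> P' e + P' (- e) <= 0].
Proof.
move=> Ps; elim: s => [|e s [Q [Qs QP Qe]]]; first by exists P; split.
have [Q' [Q's Q'Q Q'e]] := sublinear_straighten e Qs.
exists Q'; split=> // [x|x]; first exact: le_trans (QP x).
rewrite in_cons => /predU1P[->//|/Qe]; apply: le_trans; exact: lerD.
Qed.

(** Once [P] is straightened to some [Q] along every [e z], the weights are [w z = Q (e z)]. *)
Lemma hahn_banach_fin (T : finType) (e : T -> V) P : sublinear P ->
  exists w : T -> R, forall a : T -> R,
    \sum_z a z * w z <= P (\sum_z a z *: e z).
Proof.
move=> /(sublinear_straighten_seq (codom e))[Q [Qs QP Qe]].
have [QD QZ] := Qs.
have Qe0 z : Q (- e z) = - Q (e z).
  apply/eqP; rewrite -subr_eq0 opprK addrC eq_le sublinearN// andbT.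
  by rewrite Qe// codom_f.
have Qge z (a : R) : a * Q (e z) <= - Q (- (a *: e z)).
  have [a0|a0|->] := ltgtP a 0.
  - by rewrite -scaleNr lerNr -mulNr; apply: QZ; rewrite oppr_gt0.
  - by rewrite -scalerN lerNr -mulrN -Qe0 QZ.
  - by rewrite scale0r oppr0 (sublinear0 Qs) mul0r oppr0.
exists (Q \o e) => a; apply: le_trans (QP _).
(* The map sending [x] to [- Q (- x)] is superadditive and lies below [Q], so it carries the
   termwise bounds [Qge] to the whole sum. *)
have: \sum_z a z * Q (e z) <= - Q (- \sum_z a z *: e z).
  elim/big_rec2 : _ => [|z y x _ yx]; first by rewrite oppr0 (sublinear0 Qs) oppr0.
  rewrite opprD; apply: le_trans (lerD (Qge z (a z)) yx) _.
  by rewrite -[leLHS]opprD lerN2 QD.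
move=> /le_trans; apply; rewrite -subr_ge0 opprK; exact: sublinearN.
Qed.

End hahn_banach.

(** * Hoelder duality and the triangle inequality for [lqnorm] *)

Lemma powR_divV (R : realType) (t u C : R) : 0 <= u -> 0 < t -> 0 < C ->
  (u / C `^ t^-1) `^ t = u `^ t / C.
Proof.
move=> u0 t0 C0; have Ct0 : 0 < C `^ t^-1 by exact: powR_gt0.
apply: (canRL (mulfK (lt0r_neq0 C0))).
have {2}-> : C = (C `^ t^-1) `^ t by rewrite -powRrM mulVf ?gt_eqF// powRr1// ltW.
rewrite -powRM ?divfK ?lt0r_neq0//; last exact: ltW.
by rewrite divr_ge0// ltW.
Qed.

Section lqnorm_duality.
Context {R : realType} {I : finType}.
Implicit Types (x y : I -> R) (p : \bar R).

Lemma lqnorm_ge0 p x : (forall i, 0 <= x i) -> 0 <= lqnorm p x.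
Proof.
move=> x0; case: p => [r||]; [exact: powR_ge0| |exact: lexx].
have [i _|I0] := pickP [pred _ : I | true]; first exact: le_trans (sup_family_ub x i).
rewrite /= (_ : range x = set0) ?sup0//.
by apply/seteqP; split=> // z [i]; have := I0 i.
Qed.

Lemma hoelder_conjugate_fin (r : R) : 1 < r ->
  exists2 s, hoelder_conjugate r%:E = s%:E & r^-1 + s^-1 = 1 /\ 0 < s.
Proof.
move=> r1; have r0 : 0 < r by exact: lt_trans r1.
exists (r / (r - 1)).
  rewrite /hoelder_conjugate/= eqe gt_eqF//.
  by rewrite -EFinD inver subr_eq0 gt_eqF.
split; last by rewrite divr_gt0// subr_gt0.
by field; rewrite subr_eq0 !gt_eqF.
Qed.

(** For [1 < p < +oo], Young's inequality is applied termwise to the two families normalised to norm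
    1. *)
Lemma hoelder_lqnorm p x y : (1 <= p)%E ->
  (forall i, 0 <= x i) -> (forall i, 0 <= y i) ->
  \sum_i x i * y i <= lqnorm p x * lqnorm (hoelder_conjugate p) y.
Proof.
wlog : p x y / exists r, p = r%:E => [wlg p1 x0 y0|[r ->{p}]].
  have [[r pr]|p_y] := pselect (exists r, p = r%:E).
    by apply: (wlg p x y (ex_intro _ r pr)).
  have -> : p = +oo%E by case: p p1 p_y {wlg} => // r _ []; exists r.
  (* Exchanging [x] and [y] reduces the exponent [+oo] to its conjugate [1]. *)
  rewrite mulrC hoelder_conjugatey; under eq_bigr do rewrite mulrC.
  by rewrite -[+oo%E]hoelder_conjugate1; apply: (wlg 1%E y x) => //; exists 1.
rewrite lee_fin le_eqVlt => /predU1P[<-|r1] x0 y0.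
  rewrite hoelder_conjugate1 /= invr1 powRr1; last first.
    by apply: sumr_ge0 => i _; exact: powR_ge0.
  rewrite mulr_suml; apply: ler_sum => i _.
  by rewrite powRr1// ler_wpM2l// sup_family_ub.
have [s -> [rs s0]] := hoelder_conjugate_fin r1.
have r0 : 0 < r by exact: lt_trans r1.
(* Normalisation requires a positive sum of powers; otherwise the family vanishes and so does the
   pairing. *)
have sum_eq0 (t : R) (z : I -> R) : 0 < t -> (forall i, 0 <= z i) ->
    0 < \sum_i z i `^ t \/ forall i, z i = 0.
  move=> t0 z0; have : 0 <= \sum_i z i `^ t by apply: sumr_ge0 => i _; exact: powR_ge0.
  rewrite le_eqVlt => /predU1P[/esym/eqP|]; last by left.
  rewrite psumr_eq0; last by move=> i _; exact: powR_ge0.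
  move=> /allP h; right => i; have /h := mem_index_enum i.
  by rewrite /= => /eqP /powR_eq0_eq0.
have [A0|xz] := sum_eq0 r x r0 x0; last first.
  by rewrite big1 ?mulr_ge0 ?lqnorm_ge0// => i _; rewrite xz mul0r.
have [B0|yz] := sum_eq0 s y s0 y0; last first.
  by rewrite big1 ?mulr_ge0 ?lqnorm_ge0// => i _; rewrite yz mulr0.
have [A AE] : exists A, A = \sum_i x i `^ r by eexists.
have [B BE] : exists B, B = \sum_i y i `^ s by eexists.
rewrite -AE in A0; rewrite -BE in B0; rewrite /= -AE -BE.
have xA i : (x i / A `^ r^-1) `^ r = x i `^ r / A by exact: powR_divV.
have yB i : (y i / B `^ s^-1) `^ s = y i `^ s / B by exact: powR_divV.
have a0 : 0 < A `^ r^-1 by exact: powR_gt0.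
have b0 : 0 < B `^ s^-1 by exact: powR_gt0.
move: (A `^ r^-1) (B `^ s^-1) a0 b0 xA yB => a b a0 b0 xA yB.
rewrite -[leRHS]mul1r -ler_pdivrMr ?mulr_gt0// mulr_suml.
(* The Young bounds add up to [r^-1 + s^-1 = 1]. *)
apply: (@le_trans _ _ (\sum_i (x i `^ r / A / r + y i `^ s / B / s))).
  apply: ler_sum => i _; rewrite -xA -yB invfM mulrACA.
  by apply: conjugate_powR => //; rewrite divr_ge0// ltW.
by rewrite big_split/= -!mulr_suml -AE -BE !divff ?gt_eqF// !mul1r rs.
Qed.

(* The extremal [x] is [y^(p-1)]; [p = 1] and [p = +oo] use the constant [1] and
   Dirac masses. *)
Lemma lqnorm_le_dual p y (c : R) : (0 < #|I|)%N -> (1 <= p)%E ->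
  (forall i, 0 <= y i) -> 0 <= c ->
  (forall x, (forall i, 0 <= x i) ->
    \sum_i x i * y i <= c * lqnorm (hoelder_conjugate p) x) ->
  lqnorm p y <= c.
Proof.
move=> /card_gt0P[i0 _]; case: p => [r|_|//]; last first.
  rewrite hoelder_conjugatey => y0 c0 yc; apply: ge_sup; first by exists (y i0), i0.
  move=> _ [i _ <-]; have := yc (fun j => (j == i)%:R) (fun=> ler0n _ _).
  rewrite (bigD1 i)//= eqxx mul1r big1 ?addr0 => [/le_trans|j /negPf->].
    apply; rewrite (bigD1 i)//= eqxx big1 => [|j /negPf->].
      by rewrite addr0 invr1 !powR1 mulr1.
    by rewrite powR0 ?oner_eq0.
  by rewrite mul0r.
rewrite lee_fin le_eqVlt => /predU1P[<-|r1] y0 c0 yc.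
  have := yc (fun=> 1) (fun=> ler01); rewrite hoelder_conjugate1 /=.
  rewrite (_ : range _ = [set 1]); last first.
    by apply/seteqP; split=> [_ [_ _ <-]//|_ ->]; exists i0.
  rewrite sup1 mulr1 invr1 powRr1; last by apply: sumr_ge0 => i _; exact: powR_ge0.
  by apply: le_trans; apply: ler_sum => i _; rewrite mul1r powRr1.
have [s rE [rs s0]] := hoelder_conjugate_fin r1; move: yc; rewrite rE /= => yc.
have r0 : 0 < r by exact: lt_trans r1.
have := yc (fun i => y i `^ (r - 1)) (fun=> powR_ge0 _ _).
have -> : \sum_i y i `^ (r - 1) * y i = \sum_i y i `^ r.
  apply: eq_bigr => i _; have [->|yi] := eqVneq (y i) 0.
    by rewrite mulr0 powR0// gt_eqF.
  by rewrite powRB ?yi ?implybT// powRr1// divfK.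
(* Conjugacy gives [(r - 1) * s = r], so both sides involve the same sum [A]; dividing by [A]^
   s^-1[then leaves]A [^ r^-1], the norm of [y]. *)
have -> : \sum_i (y i `^ (r - 1)) `^ s = \sum_i y i `^ r.
  apply: eq_bigr => i _; rewrite -powRrM; congr (_ `^ _).
  have -> : r = (1 - s^-1)^-1 by rewrite -rs addrK invrK.
  have : 1 - s^-1 != 0 by rewrite -rs addrK invr_eq0 gt_eqF.
  move=> h; field; rewrite gt_eqF//= subr_eq0.
  by apply: contraNneq h => ->; rewrite invr1 subrr.
set A := \sum_i _; have : 0 <= A by apply: sumr_ge0 => i _; exact: powR_ge0.
rewrite le_eqVlt => /predU1P[<- _|A0]; first by rewrite powR0// invr_eq0 gt_eqF.
rewrite -ler_pdivrMr ?powR_gt0//; apply: le_trans.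
rewrite ler_pdivlMr ?powR_gt0// -powRD rs ?powRr1//; first exact: ltW.
by rewrite (gt_eqF A0) implybT.
Qed.

(** Scaling the zero family by 2 doubles its norm and leaves it unchanged. *)
Lemma lqnorm0 p : (0 < #|I|)%N -> (1 <= p)%E -> lqnorm p (fun _ : I => 0 : R) = 0.
Proof.
move=> I0 p1; have := lqnormZ I0 p1 (ltr0Sn R 1) (fun _ : I => lexx 0).
by under eq_fun do rewrite mulr0; lra.
Qed.

(** By duality it suffices to pair [x + y] with a test family, and Hoelder bounds the two resulting
    pairings separately. *)
Lemma minkowski_lqnorm p x y : (0 < #|I|)%N -> (1 <= p)%E ->
  (forall i, 0 <= x i) -> (forall i, 0 <= y i) ->
  lqnorm p (fun i => x i + y i) <= lqnorm p x + lqnorm p y.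
Proof.
move=> I0 p1 x0 y0; apply: lqnorm_le_dual => //.
- by move=> i; rewrite addr_ge0.
- by rewrite addr_ge0// lqnorm_ge0.
move=> z z0; rewrite mulrDl; under eq_bigr do rewrite mulrC mulrDl.
by rewrite big_split lerD// hoelder_lqnorm.
Qed.

Lemma le_lqnorm p x y : (0 < #|I|)%N -> (1 <= p)%E ->
  (forall i, 0 <= x i) -> (forall i, x i <= y i) -> lqnorm p x <= lqnorm p y.
Proof.
move=> I0 p1 x0 xy; have y0 i : 0 <= y i by exact: le_trans (xy i).
apply: lqnorm_le_dual => // [|z z0]; first exact: lqnorm_ge0.
apply: le_trans (hoelder_lqnorm p1 y0 z0).
by apply: ler_sum => i _; rewrite mulrC ler_wpM2r.
Qed.

End lqnorm_duality.

(** * Finitely supported probabilities and integration over pairs of configurations *)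

Lemma discrete_probability d (T : measurableType d) (R : realType)
    (J : finType) (x : J -> T) (w : J -> R) :
  (forall j, 0 <= w j) -> \sum_j w j = 1 ->
  exists P : probability T R, forall A,
    P A = (\sum_j w j * \1_A (x j))%:E.
Proof.
move=> w0 w1.
have [m mE] : exists m : {measure set T -> \bar R}, forall A,
    m A = (\sum_j w j * \1_A (x j))%:E.
  elim: (index_enum J) => [|j s [m mE]].
    by exists mzero => A; rewrite big_nil.
  exists (measure_add (mscale (NngNum (w0 j)) (dirac (x j))) m) => A.
  by apply: etrans (measure_addE _ _ A) _; rewrite mE big_cons EFinD.
have mT : m setT = 1%E.
  by rewrite mE -w1; congr EFin; apply: eq_bigr => j _; rewrite indicT mulr1.
(* The total mass is already 1: normalising only packages [m] as a probability, and the default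
   [dirac point] is never reached. *)
exists (mnormalize m (dirac point)) => A.
by rewrite /= /mnormalize mT onee_eq0 /= invr1 mule1 mE.
Qed.

Section config_integral.
Context {R : realType} {S : pointedFinType} {I : finType}.
Local Notation Omega := (config S I).
Implicit Types (mu nu : probability Omega R)
  (Pi : probability (Omega * Omega)%type R).

(** The product sigma-algebra is not discrete by definition, but every set of pairs is a finite
    union of products of singletons. *)
Lemma measurable_config2 (A : set (Omega * Omega)) : measurable A.
Proof.
rewrite -[A]image_id -bigcup_imset1; apply: fin_bigcup_measurable => //.
move=> [s t] _; rewrite (_ : [set _] = [set s] `*` [set t]) //.
  exact: measurableX.
by apply/seteqP; split=> [_ ->//|[u v] [/= -> ->]].
Qed.

Lemma config2_integrable Pi (g : Omega * Omega -> R) :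
  Pi.-integrable setT (EFin \o g).
Proof.
apply: measurable_bounded_integrable => //.
- by have := probability_setT Pi; rewrite /= => ->; rewrite ltry.
- by move=> _ B _; exact: measurable_config2.
exists (\sum_z `|g z|); split; first exact: num_real.
move=> N MN z _; apply: le_trans (ltW MN).
by rewrite (bigD1 z)//= lerDl sumr_ge0.
Qed.

Lemma Rintegral_marginal Pi mu (h : Omega * Omega -> Omega) (f : Omega -> R) :
  measurable_fun setT h ->
  (forall A : set Omega, measurable A -> Pi (h @^-1` A) = mu A) ->
  \int[mu]_x f x = \int[Pi]_z f (h z).
Proof.
move=> mh hE; congr fine.
rewrite -(@integral_pushforward _ _ _ _ _ h mh Pi setT (EFin \o f))//.
- apply: eq_measure_integral => A mA _; rewrite /pushforward; exact/esym/hE.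
- exact: (config2_integrable Pi (f \o h)).
Qed.

Lemma Rintegral_disagree Pi (l : I -> R) :
  \int[Pi]_z (\sum_i l i * \1_(disagree i) z) =
  \sum_i l i * fine (Pi (disagree i)).
Proof.
have intE (g : Omega * Omega -> R) : Pi.-integrable setT (EFin \o g).
  exact: config2_integrable.
elim: (index_enum I) => [|i s IH].
  by under eq_Rintegral do rewrite big_nil; rewrite Rintegral_cst ?mul0r ?big_nil.
under eq_Rintegral do rewrite big_cons.
rewrite RintegralD// IH big_cons RintegralZl//; congr (_ * _ + _).
rewrite /Rintegral integral_indic ?setIT//; exact: measurable_config2.
Qed.

(** Change [s] into [t] one coordinate at a time: each change at [i] costs at most [osc f i]. The
    induction is on the number of disagreeing coordinates. *)
Lemma osc_disagree (f : Omega -> R) (s t : Omega) :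
  f s - f t <= \sum_i osc f i * \1_(disagree i) (s, t).
Proof.
have [n] := ubnP #|[pred j | s j != t j]|.
elim: n s => // n IH s; rewrite ltnS => sn.
have [st|/forallPn[i sti]] := boolP [forall i, s i == t i].
  have -> : s = t by apply/ffunP => i; exact/eqP/(forallP st).
  by rewrite subrr sumr_ge0// => i _; rewrite mulr_ge0// osc_ge0.
pose s' : Omega := [ffun j => if j == i then t i else s j].
have s'E j : j != i -> s' j = s j by move=> ji; rewrite ffunE (negbTE ji).
rewrite -(subrK (f s') (f s)) -addrA (bigD1 i)//=.
rewrite indicE mem_set// mulr1; apply: lerD.
  by apply: osc_ub => j ji; rewrite s'E.
apply: le_trans (IH s' _) _.
  apply: leq_trans sn; apply: proper_card; apply/properP; split.
    apply/fintype.subsetP => j; rewrite !inE ffunE.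
    by case: (eqVneq j i) => [->|//]; rewrite eqxx.
  by exists i; rewrite !inE ?ffunE ?eqxx.
(* Passing from [s] to [s'] removes the term at [i] and keeps all the others. *)
rewrite (bigD1 i)//= [X in X + _](_ : _ = 0) ?add0r.
  apply: ler_sum => j ji; rewrite ler_wpM2l ?osc_ge0// !indicE.
  suff -> : ((s', t) \in disagree j) = ((s, t) \in disagree j) by [].
  by apply/idP/idP; rewrite !inE /disagree /= s'E.
by rewrite indicE memNset ?mulr0//= /disagree/= ffunE !eqxx.
Qed.

Lemma ipm_le_coupling mu nu Pi (f : Omega -> R) : coupling mu nu Pi ->
  \int[mu]_x f x - \int[nu]_x f x <=
  \sum_i osc f i * fine (Pi (disagree i)).
Proof.
move=> [Pi1 Pi2]; rewrite -Rintegral_disagree.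
rewrite (Rintegral_marginal f measurable_fst Pi1).
rewrite (Rintegral_marginal f measurable_snd Pi2).
rewrite -RintegralB//; [|exact: config2_integrable..].
apply: le_Rintegral => //; [exact: config2_integrable..|].
by move=> [s t] _; exact: osc_disagree.
Qed.

End config_integral.

(** * Comparison of the coupling functional with the integral probability metric *)

Section duality.
Context {R : realType} {S : pointedFinType} {I : finType}.
Local Notation Omega := (config S I).
Local Notation disagree_dist l z := (\sum_i l i * \1_(disagree i) z).
Implicit Types (p : \bar R) (c : R) (l : I -> R) (f g : Omega -> R)
  (Pi : probability (Omega * Omega)%type R).

Let marg Pi i := fine (Pi (disagree i)).

Lemma config_RintegralD (P : probability Omega R) f g :
  \int[P]_x (f x + g x) = \int[P]_x f x + \int[P]_x g x.
Proof. by rewrite RintegralD//; exact: config_integrable. Qed.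

Lemma config_RintegralZl (P : probability Omega R) (a : R) f :
  \int[P]_x (a * f x) = a * \int[P]_x f x.
Proof. by rewrite RintegralZl//; exact: config_integrable. Qed.

Lemma le_config_Rintegral (P : probability Omega R) f g :
  (forall s, f s <= g s) -> \int[P]_x f x <= \int[P]_x g x.
Proof. by move=> fg; apply: le_Rintegral => //; exact: config_integrable. Qed.

Lemma fin_num_disagree Pi i : Pi (disagree i) = (marg Pi i)%:E.
Proof. by rewrite fineK// fin_num_measure//; exact: measurable_config2. Qed.

Lemma marg_ge0 Pi i : 0 <= marg Pi i.
Proof. exact: fine_ge0. Qed.

(** With [coupling_dist_ge], this makes [coupling_dist] the infimum of [lqnorm p (marg Pi)] over
    couplings, the power [r^-1] being monotone. *)
Lemma coupling_dist_le p (mu nu : probability Omega R) Pi :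
  (0 < #|I|)%N -> (1 <= p)%E -> coupling mu nu Pi ->
  (coupling_dist p mu nu <= (lqnorm p (marg Pi))%:E)%E.
Proof.
move=> I0 + PiC; case: p => [r|_|//].
  rewrite lee_fin => r1 /=; have r0 : 0 < r by exact: lt_le_trans r1.
  rewrite -poweR_EFin; apply: gt0_ler_poweR.
  - by rewrite invr_ge0 ltW.
  - rewrite in_itv/= leey andbT; apply: le_ereal_inf_tmp => _ [Q _ <-].
    by apply: sume_ge0 => i _; exact: poweR_ge0.
  - by rewrite in_itv/= leey andbT lee_fin sumr_ge0// => i _; exact: powR_ge0.
  apply: ereal_inf_lbound; exists Pi => //; rewrite -sumEFin.
  by apply: eq_bigr => i _; rewrite fin_num_disagree poweR_EFin.
apply: (@le_trans _ _ (ereal_sup (range (fun i => Pi (disagree i))))).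
  by apply: ereal_inf_lbound; exists Pi.
apply: ge_ereal_sup => _ [i _ <-].
by rewrite fin_num_disagree lee_fin; exact: sup_family_ub.
Qed.

Lemma coupling_dist_ge p (mu nu : probability Omega R) (x : R) :
  (0 < #|I|)%N -> (1 <= p)%E ->
  (forall Pi, coupling mu nu Pi -> x <= lqnorm p (marg Pi)) ->
  (x%:E <= coupling_dist p mu nu)%E.
Proof.
move=> /card_gt0P[i0 _]; case: p => [r|_|//]; last first.
  move=> xle; apply: le_ereal_inf_tmp => _ [Pi PiC <-].
  rewrite [X in ereal_sup X](_ : _ = EFin @` range (marg Pi)); last first.
    rewrite image_comp; congr image; apply/funext => i /=.
    exact: fin_num_disagree.
  rewrite ereal_sup_EFin ?lee_fin; first exact: xle.
    by exists (sup (range (marg Pi))) => _ [i _ <-]; exact: sup_family_ub.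
  by exists (marg Pi i0), i0.
rewrite lee_fin => r1 xle; have r0 : 0 < r by exact: lt_le_trans r1.
have [x0|x0] := leP x 0; first by apply: le_trans (poweR_ge0 _ _); rewrite lee_fin.
have -> : x%:E = ((x `^ r)%:E `^ r^-1)%E.
  by rewrite poweR_EFin -powRrM divff ?gt_eqF// powRr1// ltW.
apply: gt0_ler_poweR; first by rewrite invr_ge0 ltW.
- by rewrite in_itv/= leey andbT lee_fin powR_ge0.
- rewrite in_itv/= leey andbT; apply: le_ereal_inf_tmp => _ [Q _ <-].
  by apply: sume_ge0 => i _; exact: poweR_ge0.
apply: le_ereal_inf_tmp => _ [Pi /xle xPi <-].
under eq_bigr do rewrite fin_num_disagree poweR_EFin.
have s0 : 0 <= \sum_i marg Pi i `^ r by apply: sumr_ge0 => i _; exact: powR_ge0.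
rewrite sumEFin lee_fin -[leRHS]powRr1// -(mulVf (lt0r_neq0 r0)) powRrM.
apply: ge0_ler_powR; rewrite ?nnegrE; [exact: ltW|exact: ltW| |exact: xPi].
exact: powR_ge0.
Qed.

Lemma ipm_le_coupling_dist p (mu nu : probability Omega R) :
  (0 < #|I|)%N -> (1 <= p)%E -> (ipm p mu nu <= coupling_dist p mu nu)%E.
Proof.
move=> I0 p1; apply: ge_ereal_sup => _ [f f1 <-].
apply: coupling_dist_ge => // Pi /(ipm_le_coupling f) /le_trans; apply.
under eq_bigr do rewrite mulrC.
apply: le_trans (hoelder_lqnorm p1 (marg_ge0 Pi) (osc_ge0 f)) _.
by rewrite ler_piMr// lqnorm_ge0//; exact: marg_ge0.
Qed.

Lemma ipm_ge0 p (mu nu : probability Omega R) :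
  (0 < #|I|)%N -> (1 <= p)%E -> (0 <= ipm p mu nu)%E.
Proof.
move=> I0 p1; apply: ereal_sup_ubound; exists (cst 0) => /=; last first.
  by rewrite !Rintegral_cst// !mul0r subrr.
rewrite (_ : osc _ = fun=> 0) ?lqnorm0 ?ler01 ?hoelder_conj_ge1//.
apply/funext => i; apply/eqP; rewrite eq_le osc_ge0 andbT.
by apply: osc_le => s t _; rewrite subrr.
Qed.

(** * Existence of an optimal coupling when the metric is finite *)

Section witness.
Context {p : \bar R} {c : R} {mu nu : probability Omega R}.
Context (I0 : (0 < #|I|)%N) (p1 : (1 <= p)%E) (pc : ipm p mu nu = c%:E).
Local Notation q := (hoelder_conjugate p).

Let q1 : (1 <= q)%E. Proof. exact: hoelder_conj_ge1. Qed.

Let c0 : 0 <= c. Proof. by rewrite -lee_fin -pc ipm_ge0. Qed.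

(** Rescaling [f] to norm at most 1 makes it admissible in the supremum defining [c]. *)
Lemma ipm_dual f l : (forall i, osc f i <= l i) ->
  \int[mu]_x f x - \int[nu]_x f x <= c * lqnorm q l.
Proof.
move=> fl; have l0 i : 0 <= l i by exact: le_trans (osc_ge0 f i) (fl i).
have N0 : 0 <= lqnorm q l by exact: lqnorm_ge0.
have test (k : R) : 0 < k -> lqnorm q l <= k ->
    \int[mu]_x f x - \int[nu]_x f x <= c * k.
  move=> k0 lk; rewrite -ler_pdivrMr// mulrC mulrBr -lee_fin -pc.
  apply: ereal_sup_ubound; exists (fun x => k^-1 * f x) => /=; last first.
    by rewrite !config_RintegralZl.
  rewrite (_ : osc _ = fun i => k^-1 * osc f i); last first.
    by apply/funext => i; rewrite oscZ// invr_gt0.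
  rewrite lqnormZ ?invr_gt0//; last exact: osc_ge0.
  rewrite ler_pdivrMl// mulr1; apply: le_trans lk.
  by apply: le_lqnorm => // i; exact: osc_ge0.
(* The norm of [l] may vanish, so the scale [k] is taken slightly larger; the excess [e / (c + 1)]
   costs at most [e] after multiplication by [c]. *)
apply/ler_addgt0Pr => e e0; set k := lqnorm q l + e / (c + 1).
have ec : 0 < e / (c + 1) by rewrite divr_gt0// ltr_wpDl.
have k0 : 0 < k by rewrite ltr_wpDl.
have lk : lqnorm q l <= k by rewrite lerDl ltW.
apply: le_trans (test k k0 lk) _.
rewrite mulrDr lerD2l mulrCA ler_piMr ?(ltW e0)//.
by rewrite ler_pdivrMr ?mul1r ?lerDl// ltr_wpDl.
Qed.

(* Infimal convolution replaces the pair of potentials by a single function that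
   is Lipschitz for the weighted Hamming distance. *)
Lemma potentials_ge0 (phi psi : Omega -> R) l : (forall i, 0 <= l i) ->
  (forall s t, 0 <= phi s + psi t + disagree_dist l (s, t)) ->
  0 <= \int[mu]_x phi x + \int[nu]_x psi x + c * lqnorm q l.
Proof.
move=> l0 pos; pose f s := inf (range (fun t => psi t + disagree_dist l (s, t))).
have fle s t : f s <= psi t + disagree_dist l (s, t).
  apply: ge_inf; last by exists t.
  by exists (- phi s) => _ [u _ <-]; rewrite -subr_ge0 opprK addrC addrA.
have fge s (x : R) : (forall t, x <= psi t + disagree_dist l (s, t)) -> x <= f s.
  move=> xle; apply: lb_le_inf; last by move=> _ [t _ <-].
  by eexists; exists point.
have fpsi t : f t <= psi t.
  apply: le_trans (fle t t) _; rewrite big1 ?addr0// => i _.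
  by rewrite indicE memNset ?mulr0//= /disagree/= eqxx.
have phif s : 0 <= phi s + f s.
  rewrite -lerBlDl sub0r; apply: fge => t.
  by rewrite -subr_ge0 opprK addrC addrA.
have fl i : osc f i <= l i.
  apply: osc_le => s t st; rewrite lerBlDr addrC -lerBlDr; apply: fge => u.
  rewrite lerBlDr; apply: le_trans (fle s u) _.
  (* Configurations equal off [i] have the same disagreements with [u] at every other site, so only
     the weight [l i] can remain. *)
  rewrite -addrA lerD2l -lerBlDl -sumrB (bigD1 i)//= big1 ?addr0 => [|j ji].
    by rewrite -mulrBr ler_piMr// lerBlDr !indicE.
  rewrite -mulrBr !indicE; suff -> : ((s, u) \in disagree j) = ((t, u) \in disagree j).
    by rewrite subrr mulr0.
  by apply/idP/idP; rewrite !inE /disagree /= st.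
(* The chain is [0 <= mu phi + mu f <= mu phi + nu f + c * ||l||_q], followed by
   [nu f <= nu psi]. *)
have h1 := ipm_dual fl.
have h2 : 0 <= \int[mu]_x phi x + \int[mu]_x f x.
  by rewrite -config_RintegralD; apply: Rintegral_ge0 => s _; exact: phif.
have h3 : \int[nu]_x f x <= \int[nu]_x psi x by exact: le_config_Rintegral.
lra.
Qed.

(* Hahn-Banach for the cost of dominating [g] by potentials plus a weighted
   Hamming distance: its linear minorants are the couplings of cost at most
   [c]. *)
Lemma optimal_coupling : exists2 Pi, coupling mu nu Pi &
  forall l, (forall i, 0 <= l i) -> \sum_i l i * marg Pi i <= c * lqnorm q l.
Proof.
pose V : lmodType R := {ffun Omega * Omega -> R^o}.
(* [A g] collects all upper bounds of the costs of dominating [g]; [P g] is its infimum. *)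
pose A (g : V) : set R := [set r | exists phi psi l, [/\ forall i, 0 <= l i,
  forall s t, g (s, t) <= phi s + psi t + disagree_dist l (s, t) &
  \int[mu]_x phi x + \int[nu]_x psi x + c * lqnorm q l <= r]].
have dist0 z : disagree_dist (fun _ : I => 0) z = 0 :> R.
  by rewrite big1// => i _; rewrite mul0r.
have [] := @sublinear_inf _ V A.
- move=> g; exists (\int[mu]_x (\sum_z `|g z|) + \int[nu]_x (0 : R) +
      c * lqnorm q (fun _ : I => 0)).
  exists (fun=> \sum_z `|g z|), (fun=> 0), (fun _ : I => 0); split=> // s t.
  rewrite dist0 !addr0.
  by rewrite (le_trans (ler_norm _))// (bigD1 (s, t))//= lerDl sumr_ge0.
- move=> a [phi [psi [l [l0 gle]]]]; apply: le_trans; apply: potentials_ge0 => // s t.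
  by apply: le_trans (gle s t); rewrite ffunE.
- move=> g h a b [phi [psi [l [l0 gle ga]]]] [phi' [psi' [l' [l'0 hle hb]]]].
  exists (fun s => phi s + phi' s), (fun s => psi s + psi' s), (fun i => l i + l' i).
  split=> [i|s t|]; first by rewrite addr_ge0.
    rewrite ffunE; apply: le_trans (lerD (gle s t) (hle s t)) _.
    under [in leRHS]eq_bigr do rewrite mulrDl.
    by rewrite big_split/=; lra.
  rewrite !config_RintegralD; apply: le_trans (lerD ga hb).
  have := ler_wpM2l c0 (minkowski_lqnorm I0 q1 l0 l'0); rewrite mulrDr; lra.
- move=> g r a r0 [phi [psi [l [l0 gle ga]]]].
  exists (fun s => r * phi s), (fun s => r * psi s), (fun i => r * l i).
  split=> [i|s t|]; first by rewrite mulr_ge0// ltW.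
    rewrite ffunE; under [in leRHS]eq_bigr do rewrite -mulrA.
    by rewrite -mulr_sumr -!mulrDr; apply: ler_wpM2l; rewrite // ltW.
  by rewrite !config_RintegralZl lqnormZ// mulrCA -!mulrDr ler_pM2l.
move=> Psub Ple.
pose e (z : Omega * Omega) : V := [ffun z' => (z' == z)%:R].
have [w wP] := hahn_banach_fin e Psub.
have sumE (a : Omega * Omega -> R) : \sum_z a z *: e z = [ffun z => a z] :> V.
  apply/ffunP => z; rewrite sum_ffunE ffunE (bigD1 z)//= !ffunE eqxx.
  rewrite big1 ?addr0 => [|z' z'z]; first exact: mulr1.
  by rewrite !ffunE eq_sym (negbTE z'z); exact: mulr0.
have wle (a : Omega * Omega -> R) phi psi l : (forall i, 0 <= l i) ->
    (forall s t, a (s, t) <= phi s + psi t + disagree_dist l (s, t)) ->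
    \sum_z a z * w z <= \int[mu]_x phi x + \int[nu]_x psi x + c * lqnorm q l.
  move=> l0 ale; apply: le_trans (wP a) (Ple _ _ _).
  exists phi, psi, l; split=> // s t.
  by rewrite sumE ffunE.
have norm0 : c * lqnorm q (fun _ : I => 0 : R) = 0 by rewrite lqnorm0 ?mulr0.
have int0 (P : probability Omega R) : \int[P]_x (0 : R) = 0.
  by rewrite Rintegral_cst ?mul0r.
(* The negative of a point mass is dominated at zero cost. *)
have w0 z : 0 <= w z.
  have := @wle (fun z' => - (z' == z)%:R) (fun=> 0) (fun=> 0) (fun _ : I => 0)
    (fun=> lexx 0).
  rewrite !int0 norm0 !addr0 (bigD1 z)//= eqxx mulN1r big1 ?addr0 => [|z' /negbTE->].
    by rewrite oppr_le0; apply => s t; rewrite dist0 !addr0 oppr_le0 ler0n.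
  by rewrite oppr0 mul0r.
(* Applying the one-sided bound to [- g] as well forces equality, which gives the marginals. *)
have marginalE (P : probability Omega R) (h : Omega * Omega -> Omega) :
    (forall g : Omega -> R, \sum_z g (h z) * w z <= \int[P]_x g x) ->
    forall g : Omega -> R, \sum_z g (h z) * w z = \int[P]_x g x.
  move=> hle g; apply/le_anti; rewrite hle/=.
  have := hle (fun s => -1 * g s); rewrite config_RintegralZl mulN1r /=.
  by under eq_bigr do rewrite mulN1r mulNr; rewrite sumrN lerN2.
have w1 : forall phi : Omega -> R, \sum_z phi z.1 * w z = \int[mu]_x phi x.
  apply: marginalE => g.
  have := @wle (fun z => g z.1) g (fun=> 0) (fun _ : I => 0) (fun=> lexx 0).
  by rewrite int0 norm0 !addr0; apply => s t; rewrite dist0 !addr0.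
have w2 : forall psi : Omega -> R, \sum_z psi z.2 * w z = \int[nu]_x psi x.
  apply: marginalE => g.
  have := @wle (fun z => g z.2) (fun=> 0) g (fun _ : I => 0) (fun=> lexx 0).
  by rewrite int0 norm0 add0r addr0; apply => s t; rewrite dist0 add0r addr0.
have sw1 : \sum_z w z = 1.
  have muT : fine (mu [set: Omega]) = 1 by rewrite probability_setT.
  have := w1 (fun=> 1); rewrite Rintegral_cst// mul1r muT => <-.
  by apply: eq_bigr => z _; rewrite mul1r.
have [Pi PiE] :=
  @discrete_probability _ (Omega * Omega)%type R _ id w w0 sw1.
have Rind (P : probability Omega R) (B : set Omega) : measurable B ->
    (\int[P]_x \1_B x)%:E = P B.
  by move=> mB; rewrite /Rintegral integral_indic ?setIT// fineK// fin_num_measure.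
exists Pi.
  split=> B mB; rewrite PiE -Rind//.
    by rewrite -w1; congr EFin; apply: eq_bigr => z _; rewrite mulrC.
  by rewrite -w2; congr EFin; apply: eq_bigr => z _; rewrite mulrC.
move=> l l0.
(* The weighted Hamming distance is dominated by itself with zero potentials, at cost
   [c * ||l||_q]. *)
have := @wle (fun z => disagree_dist l z) (fun=> 0) (fun=> 0) l l0.
rewrite !int0 !add0r => /(_ _)/(le_trans _); apply => [|s t]; last by rewrite !add0r.
under [leRHS]eq_bigr do rewrite mulr_suml.
rewrite exchange_big; apply: ler_sum => i _; rewrite /marg PiE /= mulr_sumr.
by apply: ler_sum => z _; rewrite mulrCA mulrC.
Qed.

End witness.

Lemma coupling_dist_eq_ipm p (mu nu : probability Omega R) :
  (0 < #|I|)%N -> (1 <= p)%E -> coupling_dist p mu nu = ipm p mu nu.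
Proof.
move=> I0 p1; apply/le_anti; rewrite ipm_le_coupling_dist// andbT.
have := ipm_ge0 mu nu I0 p1.
(* Nonnegativity excludes [-oo], and [+oo] bounds everything, so only a finite value calls for the
   optimal coupling. *)
case pc : (ipm p mu nu) => [c| |] //; last by move=> _; exact: leey.
rewrite lee_fin => c0; have [Pi PiC Pic] := optimal_coupling I0 p1 pc.
apply: le_trans (coupling_dist_le I0 p1 PiC) _.
by rewrite lee_fin; apply: lqnorm_le_dual => // i; exact: marg_ge0.
Qed.

End duality.

Theorem theorem4p1 (R : realType) (S : pointedFinType) (d : nat)
    (hd : (0 < d)%N) (Lambda : {fset 'rV[int]_d}) (hL : Lambda != fset0)
    (p : \bar R) (hp : (1 <= p)%E)
    (mu nu : probability (config S Lambda) R) :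
  coupling_dist p mu nu = ipm p mu nu.
Proof.
apply: coupling_dist_eq_ipm => //.
by rewrite -cardfE cardfs_gt0.
Qed.
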